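(* For every $\gamma\in(0,1/2)$ there exist constants $K_\gamma,\tau_\gamma>0$ such that for every $m>K_\gamma$ and every $n\in\mathbb{N}$ there exists an instance of the resource sharing problem with $n+2$ customers, $2m$ resources and $\lambda^*=1$ such that, for any $\delta\in(0,1/10)$, any version of the generic restricted block-coordinate scheme (described in the context) requires at least \[\tau_\gamma(n+m)\min\left\{\frac{\log m}{\delta^2},\,m^{1/2-\gamma}\right\}\] oracle calls to compute a $(1+\delta)$-approximate solution, i.e. some $x\in\mathcal{X}$ with $\|x\|_\infty\le(1+\delta)\lambda^*$.
   Context: Resource sharing problem: finite sets $\mathcal{C}$ (customers) and $\mathcal{R}$ (resources); for each $C\in\mathcal{C}$ a nonempty closed convex $X_C\subseteq\mathbb{R}^{\mathcal{R}}_{\ge0}$ and an oracle $f_C:\mathbb{R}^{\mathcal{R}}_{\ge0}\to X_C$ (part of the instance) with $\langle y,f_C(y)\rangle\le\sigma\min_{x\in X_C}\langle y,x\rangle$; $\mathcal{X}=\sum_C X_C$ (Minkowski sum); $\lambda^*=\min_{x\in\mathcal{X}}\|x\|_\infty$. An oracle call is an evaluation of some $f_C$. Generic restricted block-coordinate scheme: it runs $T\in\mathbb{N}$ phases; in phase $t$ it processes every customer $C\in\mathcal{C}$ as follows: set $\alpha=0$, $s^{(t)}_C=0$; while $\alpha<1$: choose any $y\in\mathbb{R}^{\mathcal{R}}_{\ge0}$ (arbitrarily, e.g. depending on everything seen so far), set $b\gets f_C(y)$, $\xi\gets\min\{1-\alpha,1/\|b\|_\infty\}$, $s^{(t)}_C\gets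 s^{(t)}_C+\xi b$, $\alpha\gets\alpha+\xi$. Then $s^{(t)}=\sum_C s^{(t)}_C$. Finally it returns a convex combination of $s^{(1)},\dots,s^{(T)}$. A ''version'' of the scheme is any choice of the price vectors, of $T$ and of the final convex combination. *)

(* Defs.v *)
From HB Require Import structures.
From mathcomp Require Import all_boot all_order all_algebra.
From mathcomp Require Import all_classical all_reals all_analysis.

Set Implicit Arguments.
Unset Strict Implicit.
Unset Printing Implicit Defensive.

Import Order.TTheory GRing.Theory Num.Theory.
Import numFieldNormedType.Exports.

Local Open Scope classical_set_scope.
Local Open Scope ring_scope.

(* A vector indexed by r resources is an element of 'rV[R]_r, on which the
   library norm `|x| and topology are those of the maximum norm. *)

Definition nonneg (R : realType) (r : nat) (x : 'rV[R]_r) : Prop :=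
  forall i, 0 <= x ord0 i.

Definition inner (R : realType) (r : nat) (x y : 'rV[R]_r) : R :=
  \sum_(i < r) x ord0 i * y ord0 i.

(* The oracles are total functions, specified (and, in the scheme below,
   evaluated) on nonnegative price vectors only. The inner products below are
   bounded below by 0, so inf is a genuine infimum. *)
Record instance (R : realType) (c r : nat) (sigma : R) := Instance {
  feasible : 'I_c -> set 'rV[R]_r;
  oracle : 'I_c -> 'rV[R]_r -> 'rV[R]_r;
  feasible_nonempty : forall C, feasible C !=set0;
  feasible_closed : forall C, closed (feasible C);
  feasible_convex : forall C, convex_set (feasible C);
  feasible_nonneg : forall C x, feasible C x -> nonneg x;
  oracle_feasible : forall C y, nonneg y -> feasible C (oracle C y);
  oracle_approx : forall C y, nonneg y ->
    inner y (oracle C y) <= sigma * inf [set inner y x | x in feasible C]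
}.

Section Scheme.
Variables (R : realType) (c r : nat) (sigma : R) (I : instance c r sigma).

Definition minkowski_sum : set 'rV[R]_r :=
  [set x | exists2 z : 'I_c -> 'rV[R]_r,
     forall C, feasible I C (z C) & x = \sum_(C < c) z C].

(* The infimum is attained: a finite Minkowski sum of nonempty closed subsets
   of the nonnegative orthant is nonempty and closed. *)
Definition opt_value : R := inf [set `|x| | x in minkowski_sum].

Definition approx_solution (delta : R) (x : 'rV[R]_r) : Prop :=
  minkowski_sum x /\ `|x| <= (1 + delta) * opt_value.

(* min {1 - alpha, 1 / `|b| }, where 1 / 0 is read as +oo. *)
Definition step_size (alpha : R) (b : 'rV[R]_r) : R :=
  if b == 0 then 1 - alpha else Num.min (1 - alpha) `|b|^-1.

(* process C alpha s k s' : from the state (alpha, s), the while loop for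
   customer C can terminate with final vector s' after exactly k oracle calls,
   for some choice of the price vectors. Since the oracle is a function, this
   covers adaptive choices of the prices. *)
Inductive process (C : 'I_c) : R -> 'rV[R]_r -> nat -> 'rV[R]_r -> Prop :=
| process_stop alpha s : 1 <= alpha -> process C alpha s 0 s
| process_call alpha s y k s' :
    alpha < 1 -> nonneg y ->
    process C (alpha + step_size alpha (oracle I C y))
      (s + step_size alpha (oracle I C y) *: oracle I C y) k s' ->
    process C alpha s k.+1 s'.

(* Some version of the scheme returns x after N oracle calls in total; k t C is
   the number of calls made for customer C in phase t. The condition on w
   forces 0 < T. *)
Definition scheme_returns (x : 'rV[R]_r) (N : nat) : Prop :=
  exists (T : nat) (k : 'I_T -> 'I_c -> nat)
         (s : 'I_T -> 'I_c -> 'rV[R]_r) (w : 'I_T -> R),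
    [/\ forall t C, process C 0 0 (k t C) (s t C),
        forall t, 0 <= w t,
        \sum_(t < T) w t = 1,
        x = \sum_(t < T) w t *: \sum_(C < c) s t C &
        N = (\sum_(t < T) \sum_(C < c) k t C)%N].

End Scheme.

(* Main.v *)
Require Import Defs.
From HB Require Import structures.
From mathcomp Require Import all_boot all_order all_algebra.
From mathcomp Require Import all_classical all_reals all_analysis.
From mathcomp Require Import ring lra zify.

Set Implicit Arguments.
Unset Strict Implicit.
Unset Printing Implicit Defensive.

Import Order.TTheory GRing.Theory Num.Theory.
Import numFieldNormedType.Exports.

(* One customer is the simplex spanned by the vectors m e_i on m resources; its
   vertices have norm m, so the step size 1/m forces m oracle calls in every
   phase, while each of the other n + 1 customers needs at least one call. Hence
   it suffices to bound the number T of phases. A second customer, on the other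
   m resources, is the hull of N = Theta(sqrt m) vectors
   v_j = (1 + (e_ij - mean_j e_ij) / 2)_i for a sign matrix e. The uniform
   combination of the v_j is the all-ones vector, so the optimum is 1. The v_j
   have norm at most 2, so T phases only produce combinations W of O(T) of them.
   If e is random and W has support of size k <= N/4, a single row exceeds
   c sqrt (log m / k) with probability of order m^(-1/4): split the support into
   Theta(log m) groups and ask each group sum to exceed half its standard
   deviation. A union bound over a fine grid of weights then produces an e for
   which every sparse W has norm at least 1 + c sqrt (log m / k). *)

Local Open Scope ring_scope.

(** * Averages and tails of Rademacher sums *)

(* The expectation of f at the Rademacher sum of the weights us. *)
Fixpoint sign_avg (R : realType) (us : seq R) (f : R -> R) : R :=
  if us is u :: us' then
    (sign_avg us' (fun x => f (u + x)) + sign_avg us' (fun x => f (- u + x))) / 2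
  else f 0.

Definition sign_tail (R : realType) (us : seq R) (t : R) : R :=
  sign_avg us (fun x => (t <= x)%R%:R).

Lemma le_sign_avg (R : realType) (us : seq R) (f g : R -> R) :
  (forall x, f x <= g x) -> sign_avg us f <= sign_avg us g.
Proof.
elim: us f g => [|u us IH] f g fg /=; first exact: fg.
by rewrite ler_pM2r ?invr_gt0// lerD// IH.
Qed.

Lemma eq_sign_avg (R : realType) (us : seq R) (f g : R -> R) :
  f =1 g -> sign_avg us f = sign_avg us g.
Proof.
by move=> fg; apply/le_anti; rewrite !le_sign_avg// => x; rewrite fg.
Qed.

Lemma sign_avg_cst (R : realType) (us : seq R) (a : R) :
  sign_avg us (fun=> a) = a.
Proof. by elim: us => //= u us ->; lra. Qed.

Lemma sign_avgD (R : realType) (us : seq R) (f g : R -> R) :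
  sign_avg us (fun x => f x + g x) = sign_avg us f + sign_avg us g.
Proof. by elim: us f g => //= u us IH f g; rewrite !IH; lra. Qed.

Lemma sign_avgN (R : realType) (us : seq R) (f : R -> R) :
  sign_avg us (fun x => f (- x)) = sign_avg us f.
Proof.
elim: us f => [|u us IH] f /=; first by rewrite oppr0.
rewrite addrC -(IH (fun x => f (u + x))) -(IH (fun x => f (- u + x))).
by congr ((_ + _) / 2); apply: eq_sign_avg => x; rewrite opprD ?opprK.
Qed.

(** For a Rademacher sum X of variance s, the second moment of c + X is c^2 + s and its fourth
    moment is at most c^4 + 6 c^2 s + 3 s^2. The shift [c] lets the induction absorb one sign at a
    time. *)
Lemma sign_avg_quartic (R : realType) (us : seq R) (al be ka c : R) :
  0 <= be -> let s := \sum_(u <- us) u ^+ 2 in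
  al * (c ^+ 2 + s) - be * (c ^+ 4 + 6 * c ^+ 2 * s + 3 * s ^+ 2) - ka <=
  sign_avg us (fun x => al * (c + x) ^+ 2 - be * (c + x) ^+ 4 - ka).
Proof.
move=> be0 /=; elim: us c => [|u us IH] c /=; first by rewrite big_nil; lra.
rewrite big_cons; set s := \sum_(u <- us) u ^+ 2 in IH *.
have E d : sign_avg us (fun x => al * (c + (d + x)) ^+ 2
      - be * (c + (d + x)) ^+ 4 - ka)
    = sign_avg us (fun x => al * ((c + d) + x) ^+ 2
      - be * ((c + d) + x) ^+ 4 - ka).
  by apply: eq_sign_avg => x; rewrite addrA.
rewrite !E; have := IH (c + u); have := IH (c + - u).
set E1 := sign_avg _ _; set E2 := sign_avg _ _ => h1 h2.
(* The slack of the induction step is exactly 2 be u^4. *)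
have bu : 0 <= be * u ^+ 4 by rewrite mulr_ge0// exprn_even_ge0.
by lra.
Qed.

Lemma sign_tail_mono (R : realType) (us : seq R) (s t : R) :
  s <= t -> sign_tail us t <= sign_tail us s.
Proof.
move=> st; apply: le_sign_avg => x.
by rewrite ler_nat; case: (leP t x) => // tx; rewrite (le_trans st tx).
Qed.

Lemma sign_tail_ge0 (R : realType) (us : seq R) (t : R) : 0 <= sign_tail us t.
Proof. by rewrite -(sign_avg_cst us 0) le_sign_avg. Qed.

Lemma sign_tail_cons (R : realType) (u : R) (us : seq R) (t : R) :
  sign_tail (u :: us) t = (sign_tail us (t - u) + sign_tail us (t + u)) / 2.
Proof.
rewrite /sign_tail /=; congr ((_ + _) / 2); apply: eq_sign_avg => x.
  by rewrite lerBlDl.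
by rewrite -lerBlDl opprK.
Qed.

(** The signs of [us] and [vs] are independent, and the two tail events together force the whole sum
    to be at least s + t. *)
Lemma sign_tail_cat (R : realType) (us vs : seq R) (s t : R) :
  sign_tail us s * sign_tail vs t <= sign_tail (us ++ vs) (s + t).
Proof.
elim: us s => [|u us IH] s /=.
  rewrite {1}/sign_tail /=; case: (leP s 0) => s0; rewrite ?mul0r ?sign_tail_ge0//.
  by rewrite mul1r sign_tail_mono// gerDr.
rewrite !sign_tail_cons -(addrAC s (- u)) (addrAC s t u).
by have := IH (s - u); have := IH (s + u); lra.
Qed.

Lemma sign_tail_double (R : realType) (us : seq R) (t : R) :
  sign_tail us t *+ 2 =
  sign_avg us (fun x => (t <= x)%R%:R + (t <= - x)%R%:R).
Proof.
by rewrite sign_avgD (sign_avgN us (fun x => (t <= x)%R%:R)) mulr2n.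
Qed.

(** X and -X have the same law, and one of them is always nonnegative. *)
Lemma sign_tail0 (R : realType) (us : seq R) : 1 / 2 <= sign_tail us 0.
Proof.
have : 1 <= sign_tail us 0 *+ 2.
  rewrite -{1}(sign_avg_cst us 1) sign_tail_double.
  by apply: le_sign_avg => x /=; rewrite oppr_ge0; case: (ltgtP 0 x) => _ /=; lra.
by lra.
Qed.

(* Paley-Zygmund by a pointwise bound: with y = x / sigma, the polynomial
   y^2/2 - y^4/16 - 1/8 is nonpositive for |y| <= 1/2 and at most 1 everywhere,
   while its mean is at least 3/16 because E y^2 = 1 and E y^4 <= 3. *)
Lemma sign_tail_stddev (R : realType) (us : seq R) :
  1 / 16 <= sign_tail us (Num.sqrt (\sum_(u <- us) u ^+ 2) / 2).
Proof.
set s := \sum_(u <- us) u ^+ 2.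
have s0 : 0 <= s by apply: sumr_ge0 => u _; rewrite sqr_ge0.
have [->|sn0] := eqVneq s 0.
  by rewrite sqrtr0 mul0r; apply: le_trans (sign_tail0 us); lra.
have sp : 0 < s by rewrite lt_def sn0.
set sg := Num.sqrt s; have sgE : sg ^+ 2 = s by rewrite sqr_sqrtr.
have sgp : 0 < sg by rewrite sqrtr_gt0.
set al := s^-1 / 2; set be := s^-1 ^+ 2 / 16.
have be0 : 0 <= be by rewrite divr_ge0// sqr_ge0.
have := @sign_avg_quartic _ us al be (1/8) 0 be0.
rewrite -/s /= !expr0n /= !mulr0 mul0r !add0r => hq.
have {}hq : 3 / 16 <= sign_avg us
    (fun x => al * (0 + x) ^+ 2 - be * (0 + x) ^+ 4 - 1 / 8).
  apply: le_trans hq; rewrite /al /be.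
  have -> : s^-1 / 2 * s - s^-1 ^+ 2 / 16 * (3 * s ^+ 2) - 1 / 8 = 3 / 16.
    by field.
  by [].
have : 3 / 16 <= sign_tail us (sg / 2) *+ 2; last by lra.
rewrite sign_tail_double; apply: le_trans hq _.
apply: le_sign_avg => x; rewrite add0r.
have yE : al * x ^+ 2 - be * x ^+ 4 - 1 / 8 =
    (x / sg) ^+ 2 / 2 - (x / sg) ^+ 4 / 16 - 1 / 8.
  rewrite /al /be -sgE.
  by field; rewrite lt0r_neq0.
rewrite yE; set y := x / sg.
have -> : x = y * sg by rewrite /y divfK// lt0r_neq0.
have c1 : (sg / 2 <= y * sg) = (1 / 2 <= y).
  by rewrite -[RHS](ler_pM2r sgp) mul1r [sg / 2]mulrC.
have c2 : (sg / 2 <= - (y * sg)) = (1 / 2 <= - y).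
  by rewrite -[RHS](ler_pM2r sgp) mul1r mulNr [sg / 2]mulrC.
rewrite c1 c2.
have q1 : y ^+ 2 / 2 - y ^+ 4 / 16 - 1 / 8 <= 1.
  have : 0 <= (y ^+ 2 - 4) ^+ 2 by rewrite sqr_ge0.
  by rewrite sqrrB -exprM; lra.
case: (leP (1/2) y) => [_|y1]; case: (leP (1/2) (-y)) => [_|y2] /=; try lra.
have y21 : y ^+ 2 <= 1 / 4 by nra.
have y4 : 0 <= y ^+ 4 by rewrite exprn_even_ge0.
by lra.
Qed.

(** Cauchy-Schwarz against the all-ones vector. It replaces the standard deviation of a group by an
    l1 norm, which is additive over groups. *)
Lemma sum_norm_le_sqrt (R : realType) (us : seq R) (g : nat) :
  (size us <= g)%N ->
  \sum_(u <- us) `|u| <= Num.sqrt g%:R * Num.sqrt (\sum_(u <- us) u ^+ 2).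
Proof.
move=> sg; rewrite -sqrtrM//.
have n0 : 0 <= \sum_(u <- us) `|u| by apply: sumr_ge0.
rewrite -[leLHS]ger0_norm// -sqrtr_sqr; apply: ler_wsqrtr.
have s0 : 0 <= \sum_(u <- us) u ^+ 2 by apply: sumr_ge0 => u _; rewrite sqr_ge0.
have : (\sum_(u <- us) `|u|) ^+ 2 <= (size us)%:R * \sum_(u <- us) u ^+ 2.
  elim: us {sg n0 s0} => [|u us IH] /=; first by rewrite !big_nil expr0n mul0r.
  rewrite !big_cons -natr1.
  set A := \sum_(v <- us) `|v| in IH *; set B := \sum_(v <- us) v ^+ 2 in IH *.
  set k := (size us)%:R in IH *.
  have uE : u ^+ 2 = `|u| ^+ 2 by rewrite real_normK// num_real.
  rewrite uE; set x := `|u|.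
  suff : 2 * x * A <= B + k * x ^+ 2 by nra.
  rewrite /A /B /k /x.
  elim: us {IH A B k} => [|v us IH] /=; first by rewrite !big_nil; lra.
  rewrite !big_cons -natr1.
  have vE : v ^+ 2 = `|v| ^+ 2 by rewrite real_normK// num_real.
  have : 0 <= (`|u| - `|v|) ^+ 2 by rewrite sqr_ge0.
  rewrite vE; nra.
move=> h; apply: le_trans h _.
by rewrite ler_wpM2r// ler_nat.
Qed.

(* Splitting the weights into L groups of size at most g, each group exceeds
   half of its standard deviation with probability at least 1/16. *)
Lemma sign_tail_groups (R : realType) (us : seq R) (g L : nat) :
  (0 < g)%N -> (size us <= L * g)%N ->
  (1 / 16) ^+ L <=
    sign_tail us ((\sum_(u <- us) `|u|) / (2 * Num.sqrt g%:R)).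
Proof.
move=> g0; elim: L us => [|L IH] us.
  rewrite mul0n leqn0 => /nilP ->.
  by rewrite big_nil mul0r expr0 /sign_tail /= lexx.
move=> sz; rewrite -{1 2}(cat_take_drop g us) big_cat /= mulrDl.
apply: le_trans (sign_tail_cat _ _ _ _); rewrite exprS.
apply: ler_pM; [by lra|by apply: exprn_ge0; lra| |].
- apply: le_trans (sign_tail_stddev _) (sign_tail_mono _ _).
  have gp : 0 < Num.sqrt g%:R :> R by rewrite sqrtr_gt0 ltr0n.
  have /sum_norm_le_sqrt h : (size (take g us) <= g)%N.
    by rewrite size_take_min geq_minl.
  by rewrite ler_pdivrMr ?mulr_gt0//; apply: le_trans h _; lra.
- by apply: IH; rewrite size_drop; lia.
Qed.

(** * Random sign rows and their greedy selection *)

Definition sgb (R : realType) (b : bool) : R := if b then 1 else -1.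

Definition flip (I : finType) (i : I) (e : {ffun I -> bool}) :=
  [ffun j => if j == i then ~~ e j else e j].

Lemma flipK (I : finType) (i : I) : involutive (flip i).
Proof. by move=> e; apply/ffunP=> j; rewrite !ffunE; case: eqP; rewrite ?negbK. Qed.

(** At distinct indices, a uniformly random [e] has independent signs. Pairing [e] with [flip i e]
    averages over the sign at [i]. *)
Lemma sum_signs_avg (R : realType) (I : finType) (u : I -> R) (s : seq I)
    (f : R -> R) : uniq s ->
  \sum_(e : {ffun I -> bool}) f (\sum_(j <- s) sgb R (e j) * u j) =
  #|{ffun I -> bool}|%:R * sign_avg (map u s) f.
Proof.
elim: s f => [|i s IH] f /=.
  by move=> _; under eq_bigr do rewrite big_nil; rewrite sumr_const mulr_natl.
case/andP => nis us.
set X := fun e : {ffun I -> bool} => \sum_(j <- s) sgb R (e j) * u j.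
set F := fun e : {ffun I -> bool} => f (\sum_(j <- i :: s) sgb R (e j) * u j).
have : \sum_e F e + \sum_e F (flip i e) = \sum_e (f (u i + X e) + f (- u i + X e)).
  rewrite -big_split /=; apply: eq_bigr => e _; rewrite /F !big_cons.
  have -> : \sum_(j <- s) sgb R (flip i e j) * u j = X e.
    rewrite /X !big_seq; apply: eq_bigr => j js; rewrite ffunE.
    by case: eqP => // ji; rewrite -ji js in nis.
  by rewrite ffunE eqxx; case: (e i) => /=; rewrite mul1r mulN1r // addrC.
have <- : \sum_e F e = \sum_e F (flip i e).
  exact: (reindex_inj (inv_inj (@flipK I i))).
rewrite big_split /= (IH (fun x => f (u i + x)))// (IH (fun x => f (- u i + x)))//.
by move=> h; rewrite mulrA mulrDr -h; field.
Qed.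

(* By averaging, some element hits a fraction p of the points not hit so far. *)
Lemma greedy_hitting (R : realType) (U W : finType) (good : U -> W -> bool)
    (p : R) (w0 : W) (m : nat) : 0 <= p <= 1 ->
  (forall u, p * #|W|%:R <= #|[set w | good u w]|%:R) ->
  exists r : nat -> W,
    #|[set u | [forall i : 'I_m, ~~ good u (r i)]]|%:R <= (1 - p) ^+ m * #|U|%:R.
Proof.
move=> /andP[p0 p1] hp; elim: m => [|m [r hr]].
  by exists (fun=> w0); rewrite expr0 mul1r ler_nat max_card.
set B := [set u | _] in hr.
have [w hw] : exists w, p * #|B|%:R <= #|[set u in B | good u w]|%:R.
  apply: contrapT => /forallNP hN.
  have lt w : #|[set u in B | good u w]|%:R < p * #|B|%:R.
    by rewrite ltNge; apply/negP/hN.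
  have : \sum_(w : W) (#|[set u in B | good u w]|%:R : R) < \sum_(w : W) p * #|B|%:R.
    by apply: ltr_sum => //; apply/hasP; exists w0; rewrite ?mem_index_enum.
  rewrite sumr_const -(mulr_natr (p * _)); apply/negP; rewrite -leNgt.
  (* Count the good pairs (u, w) with u in [B] in two ways. *)
  have -> : \sum_(w : W) (#|[set u in B | good u w]|%:R : R) =
      \sum_(u in B) #|[set w | good u w]|%:R.
    under eq_bigr do rewrite -sum1_card natr_sum big_mkcond /=.
    rewrite exchange_big [RHS]big_mkcond /=; apply: eq_bigr => u _.
    case: ifPn => uB; last first.
      by rewrite big1// => w _; rewrite inE (negbTE uB).
    rewrite -sum1_card natr_sum [RHS]big_mkcond /=; apply: eq_bigr => w _.
    by rewrite inE uB /= inE.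
  apply: le_trans (ler_sum _ (fun u _ => hp u)).
  by rewrite sumr_const -(mulr_natr (p * _)) mulrAC.
exists (fun i => if i == m then w else r i).
set B' := [set u | _].
have : (#|B'| + #|[set u in B | good u w]| <= #|B|)%N.
  rewrite -cardsUI.
  have -> : B' :&: [set u in B | good u w] = finset.set0.
    apply/setP => u; rewrite !inE; apply/negP => /andP[/forallP/(_ ord_max)].
    by rewrite /= eqxx => /negbTE ->; rewrite andbF.
  rewrite cards0 addn0; apply/subset_leq_card/fintype.subsetP => u; rewrite !inE.
  case/orP => [/forallP h|/andP[]//]; apply/forallP => i.
  by have := h (widen_ord (leqnSn m) i); rewrite /= ltn_eqF.
rewrite -(ler_nat R) natrD => hB; rewrite exprS -mulrA.
have : #|B'|%:R <= (1 - p) * #|B|%:R by lra.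
move=> /le_trans; apply.
by rewrite ler_wpM2l// subr_ge0.
Qed.

(* For weights W summing to 1, this is the W-average of the centred row
   e_j - mean e. *)
Definition row_form (R : realType) (N : nat) (W : 'I_N -> R)
    (e : {ffun 'I_N -> bool}) : R :=
  \sum_j (W j - N%:R^-1) * sgb R (e j).

(** The coordinates are listed with the support of [W] first. There the group bound applies; the
    other coordinates contribute an independent symmetric sum, which is nonnegative with probability
    at least 1/2. *)
Lemma row_form_tail (R : realType) (N L g : nat) (W : 'I_N -> R) :
  let S := [set j | W j != 0] in
  (0 < g)%N -> (#|S| <= L * g)%N ->
  (1 / 16) ^+ L / 2 * #|{ffun 'I_N -> bool}|%:R <=
  #|[set e : {ffun 'I_N -> bool} |
      (\sum_(j in S) `|W j - N%:R^-1|) / (2 * Num.sqrt g%:R) <= row_form W e]|%:R :> R.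
Proof.
move=> S g0 Sg; set t := (\sum_(j in S) _) / _; set u := fun j => W j - N%:R^-1.
set s := enum S ++ enum (~: S).
have us : uniq s.
  rewrite cat_uniq !enum_uniq andbT /=; apply/hasPn => j.
  by rewrite !mem_enum inE.
have sE (F : 'I_N -> R) : \sum_(j <- s) F j = \sum_j F j.
  rewrite big_cat /= !big_enum /= [RHS](bigID (mem S)) /=; congr (_ + _).
  by apply: eq_bigl => j; rewrite inE.
have -> : #|[set e | t <= row_form W e]|%:R = \sum_(e : {ffun 'I_N -> bool})
    (fun x => (t <= x)%R%:R) (\sum_(j <- s) sgb R (e j) * u j) :> R.
  rewrite -sum1_card natr_sum big_mkcond /=; apply: eq_bigr => e _.
  rewrite inE sE /row_form.
  under [in RHS]eq_bigr do rewrite mulrC.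
  by case: (t <= _).
rewrite (sum_signs_avg u (fun x => (t <= x)%R%:R) us).
rewrite mulrC ler_wpM2l// map_cat -[leRHS]/(sign_tail _ t).
rewrite -[t]addr0; apply: le_trans (sign_tail_cat _ _ _ _).
apply: ler_pM; [by apply: exprn_ge0; lra|by lra| |]; last first.
  by have := sign_tail0 [seq u i | i <- enum (~: S)]; lra.
have := @sign_tail_groups R [seq u i | i <- enum S] g L g0.
by rewrite size_map -cardE => /(_ Sg); rewrite big_map big_enum.
Qed.

(** * Existence of the sign matrix *)

Lemma bernoulli (R : realType) (x : R) (n : nat) :
  0 <= x -> 1 + n%:R * x <= (1 + x) ^+ n.
Proof.
move=> x0; elim: n => [|n IH]; first by rewrite mul0r addr0 expr0.
rewrite exprS -natr1; have n0 : 0 <= n%:R :> R by [].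
have : (1 + x) * (1 + n%:R * x) <= (1 + x) * (1 + x) ^+ n.
  by rewrite ler_wpM2l// addr_ge0.
by have : 0 <= n%:R * x * x; [rewrite !mulr_ge0|lra].
Qed.

(** With x = 1/n, (1 - x)^n (1 + x)^n is at most 1, while (1 + x)^n is at least 2 by Bernoulli's
    inequality. *)
Lemma onem_inv_exp (R : realType) (n : nat) :
  (0 < n)%N -> (1 - n%:R^-1) ^+ n <= 2^-1 :> R.
Proof.
move=> n0; have np : 0 < n%:R :> R by rewrite ltr0n.
have x0 : 0 <= n%:R^-1 :> R by rewrite invr_ge0.
have x1 : n%:R^-1 <= 1 :> R by rewrite invf_le1// ler1n.
have := bernoulli n x0; rewrite divff ?lt0r_neq0// => h2.
have : (1 - n%:R^-1) ^+ n * (1 + n%:R^-1) ^+ n <= 1 :> R.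
  by rewrite -exprMn exprn_ile1//; nra.
have : 0 <= (1 - n%:R^-1) ^+ n :> R by rewrite exprn_ge0// subr_ge0.
nra.
Qed.

Lemma linear_lt_exp2 (b : nat) : (7 <= b)%N -> (4 * b + 13 < 2 ^ b)%N.
Proof.
elim: b => // b IH; rewrite leq_eqVlt => /orP[/eqP <- //|/IH].
by rewrite expnS; lia.
Qed.

(** The first factor is the fraction of grid points missed by m greedy rows, the second the size of
    the grid. The hitting probability is 2^-e with e about a/2 at most, so 4^a rows reduce the
    fraction to 2^-(2^(a-e) 2^a), while the grid has at most 2^((2a+9) 2^a) points. *)
Lemma net_hit_bound (R : realType) (a m : nat) :
  (16 <= a)%N -> (4 ^ a <= m)%N ->
  (1 - (1 / 16) ^+ (a %/ 8) / 2) ^+ m *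
    ((2 ^ (2 * a + 8)).+1 ^ (2 ^ a))%:R < 1 :> R.
Proof.
move=> a16 am; set L := (a %/ 8)%N; set e := (4 * L + 1)%N.
have Ha : (8 * L <= a)%N by rewrite mulnC leq_trunc_div.
have -> : (1 / 16) ^+ L / 2 = (2 ^ e)%:R^-1 :> R.
  have -> : 1 / 16 = 2^-1 ^+ 4 :> R by field.
  by rewrite -exprM -exprSr exprVn natrX /e addn1.
set p : R := _^-1.
have p01 : 0 <= 1 - p <= 1.
  rewrite subr_ge0 gerBl invr_ge0 ler0n andbT invf_le1 ?ler1n ?ltr0n ?expn_gt0//.
have eq2a : (4 ^ a = 2 ^ e * (2 ^ (a - e) * 2 ^ a))%N.
  by rewrite -[4%N]/(2 ^ 2)%N -expnM -!expnD; congr (2 ^ _)%N; lia.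
have h1 : (1 - p) ^+ m <= 2^-1 ^+ (2 ^ (a - e) * 2 ^ a).
  have /andP[q0 q1] := p01.
  apply: le_trans (ler_wiXn2l q0 q1 am) _.
  by rewrite eq2a exprM lerXn2r ?nnegrE ?exprn_ge0 ?invr_ge0// onem_inv_exp// expn_gt0.
have h2 : ((2 ^ (2 * a + 8)).+1 ^ (2 ^ a) <= 2 ^ ((2 * a + 9) * 2 ^ a))%N.
  rewrite expnM leq_exp2r ?expn_gt0//.
  have -> : (2 * a + 9 = (2 * a + 8).+1)%N by lia.
  have : (0 < 2 ^ (2 * a + 8))%N by rewrite expn_gt0.
  by rewrite [(2 ^ (2 * a + 8).+1)%N]expnS; move: (2 ^ _)%N => x; lia.
have h3 : ((2 * a + 9) * 2 ^ a < 2 ^ (a - e) * 2 ^ a)%N.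
  rewrite ltn_pmul2r ?expn_gt0//.
  (* Since 8 L <= a and a >= 16, a - e is at least 7 and 2 a + 9 is at most 4 (a - e) + 13. *)
  by apply: leq_ltn_trans (@linear_lt_exp2 (a - e) _); lia.
apply: (@le_lt_trans _ _ (2^-1 ^+ (2 ^ (a - e) * 2 ^ a) * 2 ^+ ((2 * a + 9) * 2 ^ a))).
  have /andP[q0 q1] := p01.
  by apply: ler_pM => //; rewrite ?exprn_ge0// -natrX ler_nat.
rewrite exprVn mulrC ltr_pdivrMr ?exprn_gt0// mul1r ltr_eXn2l//; lra.
Qed.

(* The weights W are rounded down to multiples of 1/Q, and the rows hit all the
   (Q + 1)^N grid points. *)
Lemma sign_matrix (R : realType) (a m : nat) :
  (16 <= a)%N -> (4 ^ a <= m)%N ->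
  exists r : nat -> {ffun 'I_(2 ^ a) -> bool},
    forall W : 'I_(2 ^ a) -> R, (forall j, 0 <= W j) -> \sum_j W j = 1 ->
    forall k, (#|[set j | W j != 0%R]| <= k)%N -> (4 * k <= 2 ^ a)%N ->
    exists2 i, (i < m)%N &
      1 / (3 * Num.sqrt (k %/ (a %/ 8)).+1%:R) <= row_form W (r i).
Proof.
move=> a16 am; set N := (2 ^ a)%N; set L := (a %/ 8)%N.
(* [Q] is 256 N^2, so rounding k weights costs at most k/Q <= 1/(256 N), which is negligible against
   the target, itself at least 1/(3 N). *)
set Q := (2 ^ (2 * a + 8))%N.
have L0 : (0 < L)%N by rewrite divn_gt0//; lia.
have N0 : (0 < N)%N by rewrite expn_gt0.
have Np : 0 < N%:R :> R by rewrite ltr0n.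
have Qp : 0 < Q%:R :> R by rewrite ltr0n expn_gt0.
have QN : (256 * N * N)%N = Q.
  by rewrite -[256%N]/(2 ^ 8)%N -!expnD; congr (2 ^ _)%N; lia.
pose V (u : {ffun 'I_N -> 'I_Q.+1}) j : R := (u j)%:R / Q%:R.
pose S u := [set j | V u j != 0].
(* [L] groups of this size cover the support of [V u]. *)
pose g u := (#|S u| %/ L).+1.
pose t u : R := (\sum_(j in S u) `|V u j - N%:R^-1|) / (2 * Num.sqrt (g u)%:R).
pose p : R := (1 / 16) ^+ L / 2.
have pp : 0 <= p <= 1.
  have h0 : 0 <= (1 / 16) ^+ L :> R by apply: exprn_ge0; lra.
  have h1 : (1 / 16) ^+ L <= 1 :> R by apply: exprn_ile1; lra.
  by rewrite /p; lra.
have := @greedy_hitting R _ _ (fun u e => t u <= row_form (V u) e) p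
  [ffun=> true] m pp.
case=> [u|r].
  apply: row_form_tail => //; rewrite -/(S u) -/(g u).
  by rewrite mulnC ltnW// ltn_ceil.
rewrite card_ffun !card_ord => hr.
exists r => W W0 W1 k Sk kN.
have WQ j : (Num.truncn (Q%:R * W j) < Q.+1)%N.
  rewrite ltnS truncn_le_nat -natr1.
  have : W j <= 1 by rewrite -W1 (bigD1 j)//= lerDl sumr_ge0.
  move=> hW; have := ler_wpM2l (ltW Qp) hW; lra.
pose u := [ffun j => Ordinal (WQ j)].
have VW j : 0 <= W j - V u j <= Q%:R^-1.
  rewrite /V ffunE /=; have h : 0 <= Q%:R * W j by rewrite mulr_ge0.
  have := truncn_itv h; rewrite -natr1; set z := _%:R => /andP[z1 z2].
  have -> : W j - z / Q%:R = (Q%:R * W j - z) / Q%:R by field; rewrite lt0r_neq0.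
  rewrite divr_ge0 ?subr_ge0//= -[leRHS]mul1r ler_wpM2r ?invr_ge0//; lra.
have V0 j : W j = 0 -> V u j = 0.
  by move=> Wj; rewrite /V ffunE /= Wj mulr0 truncn0 mul0r.
have sS : S u \subset [set j | W j != 0].
  by apply/fintype.subsetP => j; rewrite !inE; apply: contra => /eqP/V0 ->.
have kSu : (#|S u| <= k)%N by apply: leq_trans Sk; apply: subset_leq_card.
have sumS (B : {set 'I_N}) (c : R) : \sum_(j in B) c = c * #|B|%:R.
  by rewrite sumr_const mulr_natr.
have kQ : k%:R / Q%:R <= 1 / 256 / N%:R :> R.
  rewrite -QN !natrM ler_pdivrMr ?mulr_gt0//.
  have -> : 1 / 256 / N%:R * (256 * N%:R * N%:R) = N%:R :> R.
    by field; rewrite lt0r_neq0.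
  by rewrite ler_nat; lia.
have WVsum : \sum_j (W j - V u j) <= k%:R / Q%:R.
  rewrite (bigID (mem [set j | W j != 0])) /= [X in _ + X]big1 ?addr0; last first.
    by move=> j; rewrite inE negbK => /eqP Wj; rewrite Wj V0// subr0.
  apply: (@le_trans _ _ (\sum_(j in [set j | W j != 0]) Q%:R^-1)).
    by apply: ler_sum => j _; have /andP[] := VW j.
  by rewrite sumS mulrC ler_wpM2r ?invr_ge0// ler_nat.
have N1 : N%:R^-1 <= 1 :> R by rewrite invf_le1// ler1n.
(* Rounding loses at most 1/256 of the total weight 1, and subtracting 1/N on at most N/4
   coordinates loses at most 1/4. *)
have sumV : 3 / 4 - 1 / 256 <= \sum_(j in S u) `|V u j - N%:R^-1|.
  apply: (@le_trans _ _ (\sum_(j in S u) (V u j - N%:R^-1))); last first.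
    by apply: ler_sum => j _; rewrite ler_norm.
  rewrite big_split /= sumS.
  have -> : \sum_(j in S u) V u j = \sum_j V u j.
    rewrite [RHS](bigID (mem (S u))) /= [X in _ + X]big1 ?addr0//.
    by move=> j; rewrite inE negbK => /eqP.
  have h1 : \sum_j (W j - V u j) = 1 - \sum_j V u j by rewrite sumrB W1.
  have h2 : N%:R^-1 * #|S u|%:R <= 1 / 4 :> R.
    rewrite mulrC ler_pdivrMr//.
    have : 4 * #|S u|%:R <= N%:R :> R by rewrite -natrM ler_nat; lia.
    lra.
  rewrite h1 in WVsum; rewrite mulNr.
  lra.
(* The number of missed grid points is an integer below 1, so [u] itself is hit. *)
have [i im hi] : exists2 i, (i < m)%N & t u <= row_form (V u) (r i).
  apply: contrapT => hN.
  have : #|[set u | [forall i : 'I_m, ~~ (t u <= row_form (V u) (r i))]]|%:R < 1 :> R.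
    exact: le_lt_trans hr (net_hit_bound R a16 am).
  rewrite ltrn1 ltnS leqn0 cards_eq0 => /eqP/setP/(_ u); rewrite !inE => /negP; apply.
  by apply/forallP => i; apply/negP => h; apply: hN; exists i.
exists i => //.
set G := (k %/ L).+1.
have Gp : 0 < Num.sqrt G%:R :> R by rewrite sqrtr_gt0 ltr0n.
have gup : 0 < Num.sqrt (g u)%:R :> R by rewrite sqrtr_gt0 ltr0n.
have gG : Num.sqrt (g u)%:R <= Num.sqrt G%:R :> R.
  by rewrite ler_wsqrtr// ler_nat ltnS leq_div2r.
have GN : Num.sqrt G%:R <= N%:R :> R.
  apply: (@le_trans _ _ G%:R).
    rewrite -[leRHS]ger0_norm// -sqrtr_sqr ler_wsqrtr// expr2 ler_peMl// ler1n//.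
  rewrite ler_nat; apply: leq_ltn_trans (leq_div k L) _.
  have lt4 n : (4 * k <= n -> 0 < n -> k < n)%N by clear; lia.
  exact: lt4.
set z := (Num.sqrt G%:R)^-1 : R.
have zg : z <= (Num.sqrt (g u)%:R)^-1 by rewrite lef_pV2.
have zN : N%:R^-1 <= z by rewrite lef_pV2.
have z0 : 0 < z by rewrite invr_gt0.
have t1 : (3 / 4 - 1 / 256) / 2 * z <= t u.
  rewrite /t invfM mulrA; apply: ler_pM => //; lra.
(* All signs have modulus 1, so rounding changes the form by at most the lost weight. *)
have hWV : row_form (V u) (r i) - k%:R / Q%:R <= row_form W (r i).
  rewrite lerBlDr -lerBlDl; apply: le_trans WVsum.
  rewrite /row_form -sumrB; apply: ler_sum => j _.
  rewrite -mulrBl; have /andP[w0 _] := VW j.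
  by rewrite /sgb; case: (r i j); lra.
(* The rounding loss is at most z/256, and (3/4 - 1/256)/2 - 1/256 exceeds 1/3. *)
rewrite invfM mulrA -/z; lra.
Qed.

Local Open Scope classical_set_scope.
Local Open Scope ring_scope.

(** * Polytopes with exact vertex oracles *)

Definition in_simplex (R : realType) (d : nat) (w : 'I_d -> R) : Prop :=
  (forall j, 0 <= w j) /\ \sum_j w j = 1.

Definition hull (R : realType) (d r : nat) (V : 'I_d -> 'rV[R]_r) :
    set 'rV[R]_r :=
  [set x | exists2 w, in_simplex w & x = \sum_j w j *: V j].

Lemma continuous_sum (R : realType) (T : topologicalType) (V : normedModType R)
    (I : Type) (s : seq I) (f : I -> T -> V) :
  (forall i, continuous (f i)) -> continuous (fun x => \sum_(i <- s) f i x).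
Proof.
move=> cf; elim: s => [|i s IH] x.
  by under eq_fun do rewrite big_nil; exact: cvg_cst.
under eq_fun do rewrite big_cons.
by apply: (@continuousD _ _ _ (f i)); [exact: cf|exact: IH].
Qed.

(** The hull is a continuous image of the standard simplex, which is compact as a closed part of the
    cube [0,1]^d. *)
Lemma hull_closed (R : realType) (d r : nat) (V : 'I_d -> 'rV[R]_r) :
  closed (hull V).
Proof.
pose D : set 'rV[R]_d := [set w | forall j, `[0, 1]%classic (w ord0 j)].
pose E : set 'rV[R]_d := [set w | \sum_j w ord0 j = 1].
pose f (w : 'rV[R]_d) := \sum_j w ord0 j *: V j.
have -> : hull V = f @` (D `&` E).
  apply/seteqP; split => [x [w [w0 w1] ->]|x [w [w0 w1] <-]].
    exists (\row_j w j); last by apply: eq_bigr => j _; rewrite mxE.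
    split; last by rewrite /E /=; under eq_bigr do rewrite mxE.
    move=> j /=; rewrite mxE in_itv /= w0 /= -w1 (bigD1 j)//= lerDl.
    by rewrite sumr_ge0.
  exists (fun j => w ord0 j) => //; split => // j.
  by have := w0 j; rewrite /= in_itv /= => /andP[].
have cf : continuous f.
  apply: continuous_sum => j x.
  by apply: continuousZr_tmp; exact: coord_continuous.
apply: compact_closed; first exact: norm_hausdorff.
apply: continuous_compact; first exact: continuous_subspaceT.
apply: compact_closedI.
  apply: (@rV_compact R _ (fun=> `[0, 1]%classic)) => _.
  exact: segment_compact.
apply: (@preimage_closed _ _ (fun w : 'rV[R]_d => \sum_j w ord0 j) [set x | x = 1]).
  move=> x _; apply: (@continuous_sum _ _ R^o) => j y.
  exact: coord_continuous.
exact: closed_eq.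
Qed.

Lemma hull_convex (R : realType) (d r : nat) (V : 'I_d -> 'rV[R]_r) :
  convex_set (hull V).
Proof.
move=> x y l; rewrite !inE => -[v [v0 v1] ->] [w [w0 w1] ->].
exists (fun j => l%:num * v j + (1 - l%:num) * w j).
  split=> [j|]; last by rewrite big_split /= -!mulr_sumr v1 w1; lra.
  by rewrite addr_ge0// mulr_ge0// ?subr_ge0.
rewrite /conv /= !scaler_sumr -big_split; apply: eq_bigr => j _.
by rewrite /= !scalerA -scalerDl.
Qed.

Lemma vertex_hull (R : realType) (d r : nat) (V : 'I_d -> 'rV[R]_r) j :
  hull V (V j).
Proof.
exists (fun i => (i == j)%:R).
  split=> // ; rewrite (bigD1 j)//= eqxx big1 ?addr0// => i /negbTE -> //.
rewrite (bigD1 j)//= eqxx scale1r big1 ?addr0// => i /negbTE ->.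
by rewrite scale0r.
Qed.

Lemma inner_sum (R : realType) (d r : nat) (y : 'rV[R]_r) (w : 'I_d -> R)
    (V : 'I_d -> 'rV[R]_r) :
  inner y (\sum_j w j *: V j) = \sum_j w j * inner y (V j).
Proof.
rewrite /inner; under [RHS]eq_bigr do rewrite mulr_sumr.
rewrite exchange_big; apply: eq_bigr => i _ /=.
rewrite summxE mulr_sumr; apply: eq_bigr => j _.
by rewrite mxE mulrCA.
Qed.

Lemma hull_nonneg (R : realType) (d r : nat) (V : 'I_d -> 'rV[R]_r) :
  (forall j, nonneg (V j)) -> forall x, hull V x -> nonneg x.
Proof.
move=> V0 x [w [w0 _] ->] i; rewrite summxE sumr_ge0// => j _.
by rewrite mxE mulr_ge0//; exact: V0.
Qed.

(** The lower bound rests on this oracle returning only vertices. *)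
Definition vertex_oracle (R : realType) (d r : nat)
    (V : 'I_d.+1 -> 'rV[R]_r) (y : 'rV[R]_r) : 'rV[R]_r :=
  V [arg min_(j < ord0) inner y (V j)]%O.

(** A linear function on the hull is minimal at a vertex, so the oracle is exact; as the value is
    nonnegative, a factor sigma >= 1 only helps. *)
Lemma vertex_oracle_approx (R : realType) (d r : nat) (sigma : R)
    (V : 'I_d.+1 -> 'rV[R]_r) (y : 'rV[R]_r) :
  1 <= sigma -> (forall j, nonneg (V j)) -> nonneg y ->
  inner y (vertex_oracle V y) <= sigma * inf [set inner y x | x in hull V].
Proof.
move=> s1 V0 y0.
have h : inner y (vertex_oracle V y) <= inf [set inner y x | x in hull V].
  apply: lb_le_inf; first by exists (inner y (V ord0)), (V ord0) => //; exact: vertex_hull.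
  move=> _ [x [w [w0 w1] ->] <-]; rewrite inner_sum /vertex_oracle.
  case: arg_minP => //= j _ jmin; rewrite -[leLHS]mul1r -w1 mulr_suml.
  by apply: ler_sum => i _; rewrite ler_wpM2l// jmin.
have : 0 <= inner y (vertex_oracle V y).
  by apply: sumr_ge0 => i _; rewrite mulr_ge0//; exact: V0.
by move: h; nra.
Qed.

Record vertices (R : realType) (r : nat) := Vertices {
  vdim : nat;
  vert : 'I_vdim.+1 -> 'rV[R]_r;
  vert_nonneg : forall j, nonneg (vert j)
}.

Definition polytope_instance (R : realType) (c r : nat) (sigma : R)
    (s1 : 1 <= sigma) (P : 'I_c -> vertices R r) : instance c r sigma :=
  @Instance R c r sigma (fun C => hull (@vert _ _ (P C)))
    (fun C => vertex_oracle (@vert _ _ (P C)))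
    (fun C => ex_intro _ _ (vertex_hull (@vert _ _ (P C)) ord0))
    (fun C => @hull_closed _ _ _ _)
    (fun C => @hull_convex _ _ _ _)
    (fun C => hull_nonneg (@vert_nonneg _ _ (P C)))
    (fun C y _ => vertex_hull _ _)
    (fun C y => vertex_oracle_approx s1 (@vert_nonneg _ _ (P C))).

(** * The maximum norm and the calls made by the while loop *)

Lemma coord_le_norm (R : realType) (r : nat) (x : 'rV[R]_r) i :
  `|x ord0 i| <= `|x|.
Proof.
rewrite [leRHS]/Num.norm /= mx_normrE.
exact: (le_bigmax _ (fun ij => `|x ij.1 ij.2|) (ord0, i)).
Qed.

Lemma norm_le_coord (R : realType) (r : nat) (x : 'rV[R]_r) (B : R) :
  0 <= B -> (forall i, `|x ord0 i| <= B) -> `|x| <= B.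
Proof.
move=> B0 xB; rewrite [leLHS]/Num.norm /= mx_normrE.
by apply: bigmax_le => // -[i j] _ /=; rewrite ord1.
Qed.

Lemma step_size_itv (R : realType) (r : nat) (al : R) (b : 'rV[R]_r) :
  al <= 1 -> 0 <= step_size al b <= 1 - al.
Proof.
move=> al1; rewrite /step_size; case: ifP => _; first by lra.
by rewrite ge_min lexx /= le_min invr_ge0 normr_ge0 subr_ge0 al1.
Qed.

Lemma step_size_le_inv (R : realType) (r : nat) (al B : R) (b : 'rV[R]_r) :
  0 < B -> B <= `|b| -> step_size al b <= B^-1.
Proof.
move=> B0 Bb; have bp := lt_le_trans B0 Bb.
rewrite /step_size -normr_eq0 gt_eqF// ge_min lef_pV2 ?posrE// Bb.
by rewrite orbT.
Qed.

(** A step after which the loop continues was not cut off at 1 - al, and [b] is nonzero, so the step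
    is the inverse of the norm of [b]. *)
Lemma step_size_ge_inv (R : realType) (r : nat) (al B : R) (b : 'rV[R]_r) :
  0 < B -> `|b| <= B -> al + step_size al b < 1 -> B^-1 <= step_size al b.
Proof.
move=> B0 bB; rewrite /step_size; case: eqVneq => [_|b0]; first by lra.
case: (leP (1 - al) `|b|^-1) => _ h; first by lra.
by rewrite lef_pV2 ?posrE ?normr_gt0.
Qed.

Lemma process_stopped (R : realType) (c r : nat) (sigma : R)
    (I : instance c r sigma) C al s k s' :
  process I C al s k s' -> 1 <= al -> k = 0%N.
Proof. by case=> // {}al {}s y {}k {}s' h _ _; rewrite leNgt h. Qed.

Lemma process_gt0 (R : realType) (c r : nat) (sigma : R)
    (I : instance c r sigma) C al s k s' :
  process I C al s k s' -> al < 1 -> (0 < k)%N.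
Proof. by case=> // {}al {}s h; rewrite ltNge h. Qed.

(** Each call advances [al] by at most 1/B. *)
Lemma process_min_calls (R : realType) (c r : nat) (sigma : R)
    (I : instance c r sigma) C (B : R) al s k s' :
  0 < B -> (forall y, nonneg y -> B <= `|oracle I C y|) ->
  process I C al s k s' -> B * (1 - al) <= k%:R.
Proof.
move=> B0 hB; elim=> {al s k s'} [al s al1|al s y k s' al1 y0 _ IH].
  by rewrite pmulr_rle0// subr_le0.
have := ler_wpM2l (ltW B0) (step_size_le_inv al B0 (hB _ y0)).
by rewrite divff ?gt_eqF// -natr1; lra.
Qed.

(** Each call except the last advances [al] by at least 1/B; the final + 1 pays for the last
    call. *)
Lemma process_max_calls (R : realType) (c r : nat) (sigma : R)
    (I : instance c r sigma) C (B : R) al s k s' :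
  0 < B -> (forall y, nonneg y -> `|oracle I C y| <= B) ->
  process I C al s k s' -> al <= 1 -> k%:R <= B * (1 - al) + 1.
Proof.
move=> B0 hB; elim=> {al s k s'} [al s al1|al s y k s' al1 y0 pr IH] al1'.
  by rewrite addr_ge0// mulr_ge0 ?subr_ge0// ltW.
have [/(process_stopped pr) ->|lt1] := leP 1 (al + step_size al (oracle I C y)).
  by rewrite lerDr mulr_ge0 ?subr_ge0// ltW.
have := ler_wpM2l (ltW B0) (step_size_ge_inv B0 (hB _ y0) lt1).
by have := IH (ltW lt1); rewrite divff ?gt_eqF// -natr1; lra.
Qed.

(** Each call adds weight to a single vertex, so the number of calls bounds the support. *)
Lemma process_weights (R : realType) (c r d : nat) (sigma : R)
    (I : instance c r sigma) C (V : 'I_d -> 'rV[R]_r) al s k s' :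
  (forall y, nonneg y -> exists j, oracle I C y = V j) ->
  process I C al s k s' -> al <= 1 ->
  exists w : 'I_d -> R, [/\ forall j, 0 <= w j, \sum_j w j = 1 - al,
    (#|[pred j | w j != 0%R]| <= k)%N & s' = s + \sum_j w j *: V j].
Proof.
move=> hV; elim=> {al s k s'} [al s al1|al s y k s' al1 y0 _ IH] al1'.
  exists (fun=> 0); split => //.
  - by rewrite big1//; apply/esym/eqP; rewrite subr_eq0 eq_le al1 al1'.
  - by rewrite eq_card0// => j; rewrite inE eqxx.
  - by rewrite big1 ?addr0// => j _; rewrite scale0r.
set xi := step_size al (oracle I C y) in IH *.
have /andP[xi0 xi1] : 0 <= xi <= 1 - al by apply: step_size_itv.
have [w [w0 w1 wk ->]] := IH ltac:(lra).
have [j0 ->] := hV _ y0.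
exists (fun j => w j + (if j == j0 then xi else 0)); split.
- by move=> j; rewrite addr_ge0//; case: ifP.
- by rewrite big_split /= -big_mkcond big_pred1_eq w1; lra.
- apply: leq_trans (_ : #|[predU1 j0 & [pred j | w j != 0%R]]| <= _)%N.
    apply/subset_leq_card/fintype.subsetP => j; rewrite !inE /=.
    by case: (j == j0) => //=; rewrite addr0.
  by rewrite cardU1; case: (_ \notin _); rewrite ?add1n ?ltnS// ltnW.
- rewrite /=; under [in RHS]eq_bigr do rewrite scalerDl.
  rewrite big_split /= [X in _ = _ + (_ + X)](bigD1 j0)//= eqxx [X in _ = _ + (_ + (_ + X))]big1 ?addr0.
    by rewrite -addrA [_ *: _ + _]addrC.
  by move=> j /negbTE ->; rewrite scale0r.
Qed.

Lemma le_coord_sum (R : realType) (c r : nat) (z : 'I_c -> 'rV[R]_r) C l :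
  (forall C, nonneg (z C)) -> z C ord0 l <= (\sum_C z C) ord0 l.
Proof.
move=> z0; rewrite summxE (bigD1 C)//= lerDl sumr_ge0// => D _; exact: z0.
Qed.

(** * The hard instance *)

(* Resources 0, ..., m-1 carry the sign matrix e, resources m, ..., 2m-1 the
   scaled simplex, where m is the successor of the parameter M. *)
Definition simplex_vertex (R : realType) (M : nat) (i : 'I_M.+1) :
    'rV[R]_(2 * M.+1) :=
  \row_l (if l == M.+1 + i :> nat then M.+1%:R else 0).

Definition centred_sign (R : realType) (d : nat) (e : {ffun 'I_d.+1 -> bool}) j
    : R := sgb R (e j) - (\sum_i sgb R (e i)) / d.+1%:R.

(** Centred signs lie in [-2, 2], so halving them keeps the entries between 0 and 2. *)
Definition sign_vertex (R : realType) (M d : nat)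
    (e : nat -> {ffun 'I_d.+1 -> bool}) (j : 'I_d.+1) : 'rV[R]_(2 * M.+1) :=
  \row_l (if (l < M.+1)%N then 1 + centred_sign R (e l) j / 2 else 0).

Lemma centred_sign_itv (R : realType) (d : nat) (e : {ffun 'I_d.+1 -> bool}) j :
  -2 <= centred_sign R e j <= 2.
Proof.
have h i : -1 <= sgb R (e i) <= 1 by rewrite /sgb; case: (e i); lra.
have d0 : 0 < d.+1%:R :> R by rewrite ltr0n.
have lo : -1 <= (\sum_i sgb R (e i)) / d.+1%:R.
  rewrite ler_pdivlMr// mulN1r -[X in - X]/(d.+1%:R) -[in leLHS](card_ord d.+1).
  rewrite -sumr_const -sumrN; apply: ler_sum => i _.
  by have /andP[] := h i.
have hi : (\sum_i sgb R (e i)) / d.+1%:R <= 1.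
  rewrite ler_pdivrMr// mul1r -[in leRHS](card_ord d.+1).
  rewrite -sumr_const; apply: ler_sum => i _.
  by have /andP[] := h i.
by have := h j; rewrite /centred_sign; move: lo hi; set mu := _ / _; move: mu (sgb R (e j)) => mu x; lra.
Qed.

(** Since the weights sum to 1, subtracting the row mean from the signs amounts to subtracting 1/N
    from the weights. *)
Lemma sum_centred_sign (R : realType) (d : nat) (W : 'I_d.+1 -> R)
    (e : {ffun 'I_d.+1 -> bool}) : \sum_j W j = 1 ->
  \sum_j W j * (1 + centred_sign R e j / 2) = 1 + row_form W e / 2.
Proof.
move=> W1; rewrite /row_form /centred_sign.
set mu := (\sum_i sgb R (e i)) / _.
have -> : \sum_j (W j - d.+1%:R^-1) * sgb R (e j) =
    \sum_j W j * sgb R (e j) - mu.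
  rewrite /mu mulrC mulr_sumr -sumrB; apply: eq_bigr => j _.
  by rewrite mulrBl.
have -> : \sum_j W j * (1 + (sgb R (e j) - mu) / 2) =
    \sum_j (W j * (1 - mu / 2) + W j * sgb R (e j) / 2).
  by apply: eq_bigr => j _; field.
rewrite big_split /= -!mulr_suml W1; lra.
Qed.

Lemma simplex_vertex_nonneg (R : realType) (M : nat) j :
  nonneg (@simplex_vertex R M j).
Proof. by move=> l; rewrite mxE; case: ifP. Qed.

Lemma sign_vertex_nonneg (R : realType) (M d : nat)
    (e : nat -> {ffun 'I_d.+1 -> bool}) j : nonneg (@sign_vertex R M d e j).
Proof.
move=> l; rewrite mxE; case: ifP => // _.
by have := centred_sign_itv R (e l) j; lra.
Qed.

Lemma zero_vertex_nonneg (R : realType) (r : nat) (j : 'I_1) :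
  nonneg (0 : 'rV[R]_r).
Proof. by move=> l; rewrite mxE. Qed.

(** The first [n] customers have only the zero vector: they add no load, yet cost a call in every
    phase. *)
Definition hard_vertices (R : realType) (M n d : nat)
    (e : nat -> {ffun 'I_d.+1 -> bool}) (C : 'I_(n + 2)) :
    vertices R (2 * M.+1) :=
  match fintype.split C with
  | inl _ => Vertices (@zero_vertex_nonneg R _)
  | inr i => if i == ord0 then Vertices (@simplex_vertex_nonneg R M)
             else Vertices (@sign_vertex_nonneg R M d e)
  end.

Lemma hard_vertices_zero (R : realType) (M n d : nat)
    (e : nat -> {ffun 'I_d.+1 -> bool}) (i : 'I_n) :
  hard_vertices R M e (lshift 2 i) = Vertices (@zero_vertex_nonneg R _).
Proof. by rewrite /hard_vertices (unsplitK (inl i)). Qed.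

Lemma hard_vertices_simplex (R : realType) (M n d : nat)
    (e : nat -> {ffun 'I_d.+1 -> bool}) :
  hard_vertices R M e (rshift n ord0) = Vertices (@simplex_vertex_nonneg R M).
Proof. by rewrite /hard_vertices (unsplitK (inr ord0)). Qed.

Lemma hard_vertices_sign (R : realType) (M n d : nat)
    (e : nat -> {ffun 'I_d.+1 -> bool}) :
  hard_vertices R M e (rshift n ord_max) = Vertices (@sign_vertex_nonneg R M d e).
Proof. by rewrite /hard_vertices (unsplitK (inr ord_max)). Qed.

Definition hard_instance (R : realType) (M n d : nat)
    (e : nat -> {ffun 'I_d.+1 -> bool}) (sigma : R) (s1 : 1 <= sigma) :=
  polytope_instance s1 (@hard_vertices R M n d e).

Lemma hard_instance_simplex_oracle (R : realType) (M n d : nat)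
    (e : nat -> {ffun 'I_d.+1 -> bool}) (sigma : R) (s1 : 1 <= sigma) y :
  exists j, oracle (hard_instance M n e s1) (rshift n ord0) y =
    simplex_vertex R j.
Proof.
by rewrite /= hard_vertices_simplex /vertex_oracle /=; eexists.
Qed.

Lemma hard_instance_sign_oracle (R : realType) (M n d : nat)
    (e : nat -> {ffun 'I_d.+1 -> bool}) (sigma : R) (s1 : 1 <= sigma) y :
  exists j, oracle (hard_instance M n e s1) (rshift n ord_max) y =
    sign_vertex R M e j.
Proof.
by rewrite /= hard_vertices_sign /vertex_oracle /=; eexists.
Qed.

Lemma hull_simplex_coord (R : realType) (M : nat) (w : 'I_M.+1 -> R)
    (i : 'I_M.+1) (l : 'I_(2 * M.+1)) : l = M.+1 + i :> nat ->
  (\sum_j w j *: simplex_vertex R j) ord0 l = M.+1%:R * w i.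
Proof.
move=> li; rewrite summxE (bigD1 i)//= !mxE li eqxx mulrC big1 ?addr0// => j.
by move=> ji; rewrite !mxE li eqn_add2l (inj_eq (@ord_inj _)) eq_sym (negbTE ji) mulr0.
Qed.

Lemma hull_simplex_coord0 (R : realType) (M : nat) (w : 'I_M.+1 -> R)
    (l : 'I_(2 * M.+1)) : (l < M.+1)%N ->
  (\sum_j w j *: simplex_vertex R j) ord0 l = 0.
Proof.
move=> lM; rewrite summxE big1// => j _.
by rewrite !mxE ltn_eqF ?mulr0// ltn_addr.
Qed.

Lemma hull_sign_coord (R : realType) (M d : nat)
    (e : nat -> {ffun 'I_d.+1 -> bool}) (w : 'I_d.+1 -> R)
    (l : 'I_(2 * M.+1)) : \sum_j w j = 1 -> (l < M.+1)%N ->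
  (\sum_j w j *: sign_vertex R M e j) ord0 l = 1 + row_form w (e l) / 2.
Proof.
move=> w1 lM; rewrite summxE -sum_centred_sign//; apply: eq_bigr => j _.
by rewrite !mxE lM.
Qed.

Lemma hull_sign_coord0 (R : realType) (M d : nat)
    (e : nat -> {ffun 'I_d.+1 -> bool}) (w : 'I_d.+1 -> R)
    (l : 'I_(2 * M.+1)) : (M.+1 <= l)%N ->
  (\sum_j w j *: sign_vertex R M e j) ord0 l = 0.
Proof.
move=> lM; rewrite summxE big1// => j _.
by rewrite !mxE ltnNge lM /= mulr0.
Qed.

Lemma in_simplex_uniform (R : realType) (d : nat) :
  in_simplex (fun _ : 'I_d.+1 => d.+1%:R^-1 : R).
Proof.
split => [j|]; first by rewrite invr_ge0.
by rewrite sumr_const card_ord -(mulr_natr _^-1) mulVf ?pnatr_eq0.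
Qed.

(** The simplex customer puts total load m on m resources, so some load is at least 1. Uniform
    weights for both nontrivial customers make every load equal to 1. *)
Lemma hard_instance_opt (R : realType) (M n d : nat)
    (e : nat -> {ffun 'I_d.+1 -> bool}) (sigma : R) (s1 : 1 <= sigma) :
  opt_value (hard_instance M n e s1) = 1.
Proof.
pose I := hard_instance M n e s1.
have Mp : 0 < M.+1%:R :> R by rewrite ltr0n.
have lb : lbound [set `|x| | x in minkowski_sum I] 1.
  move=> _ [_ [z hz ->] <-].
  have [w [w0 w1] zE] : hull (@simplex_vertex R M) (z (rshift n ord0)).
    by have := hz (rshift n ord0); rewrite /= hard_vertices_simplex.
  set x := \sum_C z C.
  have z0 C : nonneg (z C) by apply: (@feasible_nonneg _ _ _ _ I C); exact: hz.
  have hi (i : 'I_M.+1) : (M.+1 + i < 2 * M.+1)%N.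
    by rewrite mul2n -addnn ltn_add2l.
  have : \sum_(i < M.+1) M.+1%:R * w i <= \sum_(i < M.+1) `|x|.
    apply: ler_sum => i _.
    rewrite -(hull_simplex_coord w (erefl : Ordinal (hi i) = M.+1 + i :> nat)%N).
    rewrite -zE; apply: le_trans (coord_le_norm _ (Ordinal (hi i))).
    by apply: le_trans (ler_norm _); exact: le_coord_sum.
  rewrite -mulr_sumr w1 sumr_const card_ord -(mulr_natl `|x|) mulrC.
  by rewrite [X in _ <= X]mulrC ler_pM2r.
pose z (C : 'I_(n + 2)) :=
  \sum_j (vdim (hard_vertices R M e C)).+1%:R^-1 *: vert (v := hard_vertices R M e C) j.
have hz : minkowski_sum I (\sum_C z C).
  exists z => // C; exists (fun=> (vdim (hard_vertices R M e C)).+1%:R^-1) => //.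
  exact: in_simplex_uniform.
have nz : `|\sum_C z C| <= 1.
  apply: norm_le_coord => // l.
  have -> : \sum_C z C = z (rshift n ord0) + z (rshift n ord_max).
    rewrite big_split_ord /= big1 ?add0r => [|i _]; last first.
      by rewrite /z hard_vertices_zero big_ord1 scaler0.
    rewrite big_ord_recl big_ord1; congr (_ + z (rshift n _)).
    exact/val_inj.
  rewrite /z hard_vertices_simplex hard_vertices_sign [vdim _]/= [vdim _]/= /=.
  rewrite mxE; have [lM|Ml] := ltnP l M.+1.
    rewrite hull_simplex_coord0// add0r hull_sign_coord//; last first.
      by case: (in_simplex_uniform R d).
    rewrite /row_form big1 ?mul0r ?addr0 ?normr1// => j _.
    by rewrite subrr mul0r.
  have lM : (l - M.+1 < M.+1)%N.
    by rewrite ltn_subLR// addnn -mul2n ltn_ord.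
  rewrite hull_sign_coord0// addr0 (@hull_simplex_coord _ _ _ (Ordinal lM)) /=.
    by rewrite divff ?gt_eqF// normr1.
  by move: Ml => /=; lia.
apply/le_anti/andP; split; last first.
  by apply: lb_le_inf => //; exists `|\sum_C z C|, (\sum_C z C).
apply: le_trans nz; apply: ge_inf; last by exists (\sum_C z C).
by exists 1.
Qed.

(** Per phase, each zero customer needs a call and the simplex customer, whose vertices have norm m,
    needs m calls. *)
Lemma hard_instance_calls (R : realType) (M n d T : nat)
    (e : nat -> {ffun 'I_d.+1 -> bool}) (sigma : R) (s1 : 1 <= sigma)
    (k : 'I_T -> 'I_(n + 2) -> nat) (s : 'I_T -> 'I_(n + 2) -> 'rV[R]_(2 * M.+1)) :
  (forall t C, process (hard_instance M n e s1) C 0 0 (k t C) (s t C)) ->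
  (T * (n + M.+1) <= \sum_(t < T) \sum_(C < n + 2) k t C)%N.
Proof.
move=> pr; rewrite mulnC -[X in (_ * X <= _)%N]card_ord mulnC -sum_nat_const.
apply: leq_sum => t _; rewrite big_split_ord /=; apply: leq_add.
  rewrite -[leqLHS]card_ord -sum1_card; apply: leq_sum => i _.
  by apply: process_gt0 (pr t _) _.
rewrite (bigD1 ord0)//=; apply: leq_trans (leq_addr _ _).
rewrite -(ler_nat R); have Mp : 0 < M.+1%:R :> R by rewrite ltr0n.
have := @process_min_calls _ _ _ _ _ _ M.+1%:R _ _ _ _ Mp _ (pr t (rshift n ord0)).
rewrite subr0 mulr1; apply=> y _.
have [j ->] := hard_instance_simplex_oracle n e s1 y.
have hj : (M.+1 + j < 2 * M.+1)%N by rewrite mul2n -addnn ltn_add2l.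
apply: le_trans (coord_le_norm _ (Ordinal hj)).
by rewrite mxE eqxx ger0_norm.
Qed.

(** [W] collects the weights that all phases give to the sign vertices. These have norm at most 2,
    so a phase uses at most 2 + 1 = 3 of them. *)
Lemma hard_instance_sparse (R : realType) (M n d T : nat)
    (e : nat -> {ffun 'I_d.+1 -> bool}) (sigma : R) (s1 : 1 <= sigma)
    (k : 'I_T -> 'I_(n + 2) -> nat) (s : 'I_T -> 'I_(n + 2) -> 'rV[R]_(2 * M.+1))
    (w : 'I_T -> R) :
  (forall t C, process (hard_instance M n e s1) C 0 0 (k t C) (s t C)) ->
  in_simplex w ->
  exists W : 'I_d.+1 -> R, [/\ in_simplex W,
    (#|[pred j | W j != 0%R]| <= 3 * T)%N &
    forall i, (i < M.+1)%N -> 1 + row_form W (e i) / 2 <=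
      `|\sum_(t < T) w t *: \sum_(C < n + 2) s t C|].
Proof.
move=> pr [w0 w1]; pose C1 := rshift n ord_max : 'I_(n + 2).
have hom t : exists om : 'I_d.+1 -> R, [/\ forall j, 0 <= om j,
    \sum_j om j = 1, (#|[pred j | om j != 0%R]| <= 3)%N &
    s t C1 = \sum_j om j *: sign_vertex R M e j].
  have orc (y : 'rV[R]_(2 * M.+1)) (_ : nonneg y) := hard_instance_sign_oracle n e s1 y.
  have [|om [om0 om1 omk ->]] := process_weights orc (pr t C1); first by lra.
  exists om; rewrite add0r; split => //; first by rewrite om1 subr0.
  apply: leq_trans omk _; rewrite -(ler_nat R).
  have := @process_max_calls _ _ _ _ _ _ 2 _ _ _ _ _ _ (pr t C1).
  move=> /(_ ltac:(lra)); rewrite subr0 => h; apply: le_trans (h _ _) _ => //.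
  - move=> y y0; have [j ->] := orc _ y0.
    apply: norm_le_coord => // l; rewrite mxE; case: ifP => _.
      by rewrite ler_norml; have := centred_sign_itv R (e l) j; lra.
    by rewrite normr0.
  - by lra.
have {hom} [om hom] := choice hom.
pose W j := \sum_t w t * om t j.
have W0 j : 0 <= W j.
  by apply: sumr_ge0 => t _; rewrite mulr_ge0//; have [] := hom t.
have W1 : \sum_j W j = 1.
  rewrite exchange_big /= -[RHS]w1; apply: eq_bigr => t _.
  by rewrite -mulr_sumr; have [_ -> _ _] := hom t; rewrite mulr1.
exists W; split => //.
  rewrite mulnC -[X in (_ <= X * _)%N]card_ord -sum_nat_const.
  apply: (@leq_trans (\sum_(t < T) \sum_(j < d.+1) (om t j != 0%R))).
    rewrite exchange_big /= -sum1_card big_mkcond; apply: leq_sum => j _ /=.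
    rewrite inE; case: ifPn => // /negP Wj; rewrite lt0n.
    apply/negP => /eqP/eqP; rewrite sum_nat_eq0 => /forallP h; apply: Wj.
    rewrite /W big1// => t _; have := h t.
    by rewrite /= eqb0 negbK => /eqP ->; rewrite mulr0.
  apply: leq_sum => t _; have [_ _ h _] := hom t; apply: leq_trans h.
  by rewrite -sum1_card [leqRHS]big_mkcond.
move=> i iM; have il : (i < 2 * M.+1)%N by rewrite mul2n -addnn ltn_addr.
apply: le_trans (coord_le_norm _ (Ordinal il)).
apply: le_trans (ler_norm _).
rewrite -(hull_sign_coord (l := Ordinal il) e W1 iM).
have -> : \sum_j W j *: sign_vertex R M e j = \sum_t w t *: s t C1.
  under [RHS]eq_bigr => t _.
    have [_ _ _ ->] := hom t; rewrite scaler_sumr; over.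
  rewrite exchange_big /=; apply: eq_bigr => j _; rewrite scaler_suml.
  by apply: eq_bigr => t _; rewrite scalerA.
rewrite !summxE; apply: ler_sum => t _; rewrite !mxE ler_wpM2l//.
(* The other customers contribute nonnegative loads, so dropping them can only lower the
   coordinate. *)
apply: le_coord_sum => C.
have orc y (_ : nonneg y) : exists j, oracle (hard_instance M n e s1) C y =
    vert (v := hard_vertices R M e C) j by eexists.
have [|om' [om0 _ _ ->]] := process_weights orc (pr t C); first by lra.
rewrite add0r => l; rewrite summxE; apply: sumr_ge0 => j _.
by rewrite mxE mulr_ge0//; exact: vert_nonneg.
Qed.

(** * Comparison of m with powers of 4, and the final bound *)

(** m is below 4^(a+1) for the truncated logarithm a, and 2 <= exp 1. *)
Lemma ln_le_trunc_log (R : realType) (m : nat) : (0 < m)%N ->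
  ln m%:R <= 2 * (trunc_log 4 m).+1%:R :> R.
Proof.
move=> m0; set a := (trunc_log 4 m).+1.
have mp : 0 < m%:R :> R by rewrite ltr0n.
rewrite -[leRHS]expRK ler_ln ?posrE ?expR_gt0//.
have ma : m%:R <= (4 ^ a)%:R :> R.
  by rewrite ler_nat ltnW// trunc_log_ltn.
apply: le_trans ma _; rewrite -[4%N]/(2 ^ 2)%N -expnM natrX.
rewrite -natrM -[X in expR X]mulr1 expRM_natl lerXn2r ?nnegrE ?expR_ge0//.
by apply: le_trans (expR_ge1Dx 1); lra.
Qed.

Lemma powR_le_trunc_log (R : realType) (m : nat) (gamma : R) :
  0 <= gamma -> (0 < m)%N ->
  m%:R `^ (1 / 2 - gamma) <= 2 * (2 ^ trunc_log 4 m)%:R.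
Proof.
move=> g0 m0; have m1 : 1 <= m%:R :> R by rewrite ler1n.
apply: (@le_trans _ _ (m%:R `^ 2^-1)); first by apply: ler_powR => //; lra.
rewrite powR12_sqrt// -[2 * _]ger0_norm// -sqrtr_sqr; apply: ler_wsqrtr.
rewrite -natrM -natrX ler_nat -expnS -expnM mulnC expnM -[(2 ^ 2)%N]/4%N.
by rewrite ltnW// trunc_log_ltn.
Qed.

Theorem theorem2 (R : realType) (gamma : R) (hgamma : 0 < gamma < 1 / 2) :
  exists K tau : R, [/\ 0 < K, 0 < tau &
    forall (sigma : R) (m n : nat), 1 <= sigma -> K < m%:R ->
    exists I : instance (n + 2) (2 * m) sigma,
      opt_value I = 1 /\
      forall delta : R, 0 < delta < 1 / 10 ->
      forall (x : 'rV[R]_(2 * m)) (N : nat),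
        scheme_returns I x N -> approx_solution I delta x ->
        tau * (n + m)%:R *
          Num.min (ln m%:R / delta ^+ 2) (m%:R `^ (1 / 2 - gamma))
        <= N%:R].
Proof.
(* The threshold 4 ^ 16 must not be evaluated as a unary number. *)
have [b b16] : exists b, b = 16%N by exists 16%N.
(* The constant 6000 leaves room for 24 * 216 = 5184, the product of the constants in [hln] and
   [hL]. *)
have [tau tau0 tau1] : exists2 tau : R, 0 < tau & 6000 * tau <= 1.
  by exists (1 / 6000); lra.
exists (4 ^ b)%:R, tau; split; [by rewrite ltr0n expn_gt0|by []|].
move=> sigma [|M] n s1; rewrite ltr_nat // => Km.
set m := M.+1 in Km *.
(* The sign customer gets 2^a vertices, a number between sqrt m / 2 and sqrt m. *)
set a := trunc_log 4 m.
have a16 : (16 <= a)%N by rewrite -b16 trunc_log_max// ltnW.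
have am : (4 ^ a <= m)%N by rewrite trunc_logP.
have dE : (2 ^ a).-1.+1 = (2 ^ a)%N by rewrite prednK// expn_gt0.
have := @sign_matrix R a m a16 am; rewrite -dE.
move: (2 ^ a).-1 dE => d dE [e he].
exists (hard_instance M n e s1); split; first exact: hard_instance_opt.
move=> delta /andP[d0 d1] x N [T [k [s [w [pr w0 w1 xE ->]]]]] [_].
rewrite hard_instance_opt mulr1 => xd.
have [W [[W0 W1] WT Wx]] := hard_instance_sparse pr (conj w0 w1).
rewrite -xE in Wx.
set mn := Num.min _ _.
suff mnT : mn <= 6000 * T%:R.
  have := hard_instance_calls pr; rewrite -(ler_nat R) natrM => h.
  apply: le_trans h; rewrite mulrAC; apply: ler_wpM2r => //.
  apply: le_trans (ler_wpM2l (ltW tau0) mnT) _.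
  by rewrite mulrA [tau * _]mulrC -[leRHS]mul1r ler_wpM2r.
(* If 3 T exceeds a quarter of the number of sign vertices, T is already of order sqrt m; otherwise
   [W] is sparse enough for the sign matrix. *)
have [T12|T12] := leqP (4 * (3 * T)) (2 ^ a)%N; last first.
  apply: (@le_trans _ _ (m%:R `^ (1 / 2 - gamma))).
    by rewrite ge_min lexx orbT.
  have /andP[g0 _] := hgamma.
  have := @powR_le_trunc_log R m gamma (ltW g0) (ltn0Sn M); rewrite -/a.
  move/le_trans; apply; move: T12; rewrite -(ltr_nat R) !natrM.
  by have : 0 <= T%:R :> R by []; lra.
apply: (@le_trans _ _ (ln m%:R / delta ^+ 2)); first by rewrite ge_min lexx.
have {he}[i im hi] := he W W0 W1 (3 * T)%N ltac:(by rewrite cardsE) ltac:(by rewrite dE).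
set L := (a %/ 8)%N in hi; set q := (3 * T %/ L)%N in hi.
have L2 : (2 <= L)%N by rewrite leq_divRL.
have aL : (a < 8 * L.+1)%N by rewrite mulnC ltn_ceil.
have qL : (q * L <= 3 * T)%N by rewrite leq_trunc_div.
have := Wx i im => xi.
have Gp : 0 < Num.sqrt q.+1%:R :> R by rewrite sqrtr_gt0 ltr0n.
have G2 : Num.sqrt q.+1%:R ^+ 2 = q.+1%:R :> R by rewrite sqr_sqrtr.
(* The load 1 + row_form / 2 is at most the norm of [x], hence at most 1 + delta. *)
have h1 : 1 <= 6 * delta * Num.sqrt q.+1%:R.
  have : 1 / (3 * Num.sqrt q.+1%:R) <= 2 * delta by lra.
  by rewrite ler_pdivrMr ?mulr_gt0//; lra.
have h2 : 1 <= 36 * delta ^+ 2 * q.+1%:R.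
  rewrite -G2 -[36](_ : 6 ^+ 2 = _) -?exprMn; first by rewrite exprn_ege1.
  by rewrite -natrX.
(* As delta < 1/10, [h2] rules out q = 0, so q + 1 <= 2 q and the rounding in the group size is
   harmless. *)
have d2 : delta ^+ 2 <= 1 / 100.
  have -> : 1 / 100 = (1 / 10) ^+ 2 :> R by field.
  by rewrite lerXn2r ?nnegrE ?ltW//; lra.
have dp : 0 < delta ^+ 2 by rewrite exprn_gt0.
have q1 : (1 <= q)%N.
  by rewrite lt0n; apply/eqP => q0; move: h2; rewrite q0; lra.
have h3 : 1 <= 72 * delta ^+ 2 * q%:R.
  apply: le_trans h2 _; have : 1 <= q%:R :> R by rewrite ler1n.
  by rewrite -natr1; nra.
have hL : L%:R <= 216 * delta ^+ 2 * T%:R.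
  have : q%:R * L%:R <= 3 * T%:R :> R by rewrite -!natrM ler_nat.
  have l0 : 0 <= L%:R :> R by [].
  move=> h4; apply: le_trans (_ : 72 * delta ^+ 2 * (3 * T%:R) <= _); last by lra.
  apply: le_trans (ler_wpM2l _ h4); last by lra.
  by rewrite mulrA -[leLHS]mul1r ler_wpM2r.
(* Here a >= 16 matters: it gives L >= 2, hence 2 (a + 1) <= 16 (L + 1) <= 24 L. *)
have hln : ln m%:R <= 24 * L%:R :> R.
  apply: le_trans (ln_le_trunc_log R (ltn0Sn M)) _; rewrite -/m -/a.
  rewrite -!natrM ler_nat.
  have lin u v : (u < 8 * v.+1 -> 2 <= v -> 2 * u.+1 <= 24 * v)%N.
    by clear; lia.
  exact: lin.
rewrite ler_pdivrMr//; have T0 : 0 <= T%:R :> R by [].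
have : 0 <= delta ^+ 2 * T%:R by rewrite mulr_ge0// ltW.
lra.
Qed.
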